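(* Let $0\le a<b<\infty$ and let $f:[a,b]\rightarrow\mathbb{R}$ be continuous on $[a,b]$ with $f\in L([a,b])$. Let $k>1$ be a real number and let $p,q>0$ be fixed real numbers. If $|f|^{\frac{k}{k-1}}$ is $P$-convex on $[a,b]$, then $$\int_a^b (x-a)^p(b-x)^q f(x)\,dx\le (b-a)^{p+q+1}\,\bigl[\beta(kp+1,kq+1)\bigr]^{\frac1k}\left(|f(a)|^{\frac{k}{k-1}}+|f(b)|^{\frac{k}{k-1}}\right)^{\frac{k-1}{k}}.$$
   Context: Let $I\subseteq\mathbb{R}$ be an interval. A function $g:I\rightarrow\mathbb{R}$ is called $P$-convex on $I$ if it is nonnegative and $g(tx+(1-t)y)\le g(x)+g(y)$ for all $x,y\in I$ and all $t\in[0,1]$. $L([a,b])$ denotes the space of Lebesgue integrable functions on $[a,b]$. $\beta$ is the Euler Beta function, $\beta(x,y)=\int_0^1 t^{x-1}(1-t)^{y-1}\,dt$ for $x,y>0$. *)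

(* Defs.v *)
From mathcomp Require Export all_boot all_order all_algebra.
From mathcomp Require Export all_classical all_reals all_analysis.
Export Order.TTheory GRing.Theory Num.Theory.
Export numFieldNormedType.Exports.

Set Implicit Arguments.
Unset Strict Implicit.
Unset Printing Implicit Defensive.

Local Open Scope classical_set_scope.
Local Open Scope ring_scope.

Definition P_convex (R : realType) (I : interval R) (g : R -> R) : Prop :=
  (forall x, x \in I -> 0 <= g x) /\
  (forall x y t, x \in I -> y \in I -> t \in `[0, 1] ->
    g (t * x + (1 - t) * y) <= g x + g y).

(* The library's [beta_fun] only takes natural-number parameters.  At the end
   points [powR] gives 0 `^ r = 0 for r != 0 (also r < 0) and 0 `^ 0 = 1; these
   two points are Lebesgue-negligible. *)
Definition Beta (R : realType) (x y : R) : R :=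
  \int[lebesgue_measure]_(t in `[0, 1]) (t `^ (x - 1) * (1 - t) `^ (y - 1)).

(* Main.v *)
(* Writing x as a convex combination of a and b, P-convexity bounds
   |f x|^(k/(k-1)) by |f a|^(k/(k-1)) + |f b|^(k/(k-1)), so f can be pulled out
   of the integral as a constant. The remaining weight becomes
   (b-a)^(p+q+1) t^p (1-t)^q after the affine change of variable
   x = a + (b-a)t, and Hoelder's inequality against the constant 1 on [0, 1]
   turns its integral into the Beta integral with exponents kp and kq. *)
Require Import Defs.
From mathcomp Require Import ring lra.

Local Open Scope classical_set_scope.
Local Open Scope ring_scope.

(* The absolute value is there because [x `^ p] is discontinuous at 0 from the
   left: it takes the junk value 1 for x < 0. *)
Lemma continuous_norm_powR (R : realType) (p : R) (hp : 0 < p) :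
  continuous (fun x : R => `|x| `^ p).
Proof.
move=> x; have [->|x0] := eqVneq x 0.
  have cv0 := powR_cvg0 hp.
  rewrite /continuous_at normr0 powR0 ?gt_eqF//.
  apply/cvgrPdist_lt => e e0.
  (* [cv0] is a limit from the right only; it suffices because [|z|] is positive for [z != 0]. *)
  move/cvgrPdist_lt : cv0 => /(_ e e0)[d /= d0 Hd].
  exists d => //= z; rewrite /ball/= sub0r normrN => zd.
  have [->|z0] := eqVneq z 0; first by rewrite normr0 powR0 ?gt_eqF// subr0 normr0.
  apply: Hd => /=; last by rewrite normr_gt0.
  by rewrite sub0r normrN normr_id.
apply: (@continuous_comp _ _ _ (fun y : R => `|y|) (fun y => y `^ p)).
  exact: norm_continuous.
apply: differentiable_continuous; apply/derivable1_diffP.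
by apply: derivable_powR; rewrite in_itv/= andbT normr_gt0.
Qed.

Lemma continuous_Rintegrable_itv (R : realType) (a b : R) (g : R -> R) :
  continuous g -> (@lebesgue_measure R).-integrable `[a, b] (EFin \o g).
Proof.
move=> cg; apply: continuous_compact_integrable; first exact: segment_compact.
exact: continuous_subspaceT.
Qed.

(** Substitution along an increasing map with constant derivative [b - a]. Continuity of [g] on the
    whole line spares any care at the end points. *)
Lemma Rintegral_affine_change (R : realType) (a b : R) (g : R -> R) :
  a < b -> continuous g ->
  \int[lebesgue_measure]_(x in `[a, b]) g x =
  (b - a) * \int[lebesgue_measure]_(t in `[0, 1]) g (a + (b - a) * t).
Proof.
move=> ab cg; pose F (t : R) := a + (b - a) * t.
have F0 : F 0 = a by rewrite /F; ring.
have F1 : F 1 = b by rewrite /F; ring.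
have ba0 : 0 < b - a by rewrite subr_gt0.
have isF (t : R) : is_derive t 1 F (b - a).
  rewrite /F; apply: is_derive_eq; rewrite /=.
  by rewrite add0r mul1r /GRing.scale/= mulr1.
have cF : continuous F.
  move=> t; apply: differentiable_continuous; apply/derivable1_diffP.
  exact: (@ex_derive _ _ _ _ _ _ _ (isF t)).
have dF : derive1 F = cst (b - a).
  by apply/funext => t; rewrite derive1E derive_val.
rewrite -RintegralZl//; last first.
  apply: (@continuous_Rintegrable_itv _ _ _ (g \o F)) => t.
  by apply: continuous_comp; [exact: cF|exact: cg].
rewrite /Rintegral; congr fine.
rewrite -{1}F0 -{1}F1 (@integration_by_substitution_increasing _ F)//.
- by apply: eq_integral => t _; rewrite dF /= mulrC.
- by move=> x y _ _ xy; rewrite /F ltrD2l ltr_pM2l.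
- by rewrite dF => ? _; exact: cvg_cst.
- by rewrite dF; exact: is_cvg_cst.
- by rewrite dF; exact: is_cvg_cst.
- split=> //.
  + by apply: cvg_at_right_filter; exact: cF.
  + by apply: cvg_at_left_filter; exact: cF.
- exact: continuous_subspaceT.
Qed.

(** Hoelder's inequality against the constant 1, obtained by integrating a pointwise Young
    inequality. The integral of [g] is never divided by, so its vanishing is no separate case. *)
Lemma Rintegral_le_powR_mean (R : realType) (k : R) (g : R -> R) :
  1 < k -> continuous g -> continuous (fun t => g t `^ k) ->
  (forall t, 0 <= g t) ->
  \int[lebesgue_measure]_(t in `[0, 1]) g t <=
  (\int[lebesgue_measure]_(t in `[0, 1]) (g t `^ k)) `^ (1 / k).
Proof.
move=> k1 cg cgk g0.
have k0 : 0 < k by lra.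
have ig := continuous_Rintegrable_itv _ 0 1 _ cg.
have igk := continuous_Rintegrable_itv _ 0 1 _ cgk.
set I := (X in X <= _); set N := (X in _ <= X `^ _).
have I0 : 0 <= I by exact: Rintegral_ge0.
have N0 : 0 <= N by apply: Rintegral_ge0 => t _; exact: powR_ge0.
have Ik : I * I `^ (k - 1) = I `^ k by rewrite mulr_powRB1.
(* Young's inequality with second factor I^(k-1); its conjugate power is I^k,
   so integrating over the probability space [0, 1] leaves I^k <= N. *)
have young t : g t * I `^ (k - 1) <= k^-1 * g t `^ k + I `^ k * (1 - k^-1).
  have := @conjugate_powR R (g t) (I `^ (k - 1)) k (k / (k - 1)) (g0 t)
    (powR_ge0 _ _).
  rewrite -powRrM; have -> : (k - 1) * (k / (k - 1)) = k by field; lra.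
  have -> : (k / (k - 1))^-1 = 1 - k^-1 by field; lra.
  rewrite -[_ / k]mulrC; apply; [lra| |lra].
  by rewrite divr_gt0//; lra.
have : I * I `^ (k - 1) <= k^-1 * N + I `^ k * (1 - k^-1).
  rewrite /I -RintegralZr// -/I /N -RintegralZl//.
  (* Since [[0, 1]] has length 1, a constant equals its own integral, and both sides become
     integrals to compare pointwise. *)
  have -> : I `^ k * (1 - k^-1) =
      \int[lebesgue_measure]_(t in `[0, 1]) (cst (I `^ k * (1 - k^-1)) t).
    rewrite Rintegral_cst//.
    rewrite [X in fine X](_ : _ = 1%E) ?mulr1//.
    apply: etrans (lebesgue_measure_itv _) _.
    by rewrite /= lte_fin ltr01 oppr0 adde0.
  have icst : (@lebesgue_measure R).-integrable `[0, 1]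
      (EFin \o cst (I `^ k * (1 - k^-1))).
    by apply: continuous_Rintegrable_itv => t; exact: cvg_cst.
  have iZ : (@lebesgue_measure R).-integrable `[0, 1]
      (EFin \o (fun t => k^-1 * g t `^ k)).
    apply: continuous_Rintegrable_itv => t.
    by apply: cvgM; [exact: cvg_cst|exact: cgk].
  rewrite -RintegralD//; apply: le_Rintegral => //.
  - apply: continuous_Rintegrable_itv => t.
    by apply: cvgM; [exact: cg|exact: cvg_cst].
  - apply: continuous_Rintegrable_itv => t.
    apply: cvgD; last exact: cvg_cst.
    by apply: cvgM; [exact: cvg_cst|exact: cgk].
rewrite Ik => le1.
(* Moving the [I]-term of [le1] to the left leaves the fraction [k^-1] of [I ^ k]. *)
have IN : I `^ k <= N.
  have : k^-1 * I `^ k <= k^-1 * N by lra.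
  by rewrite ler_pM2l// invr_gt0.
have -> : I = (I `^ k) `^ (1 / k).
  by rewrite -powRrM mulrC divfK ?gt_eqF// powRr1.
apply: ge0_ler_powR => //; rewrite ?nnegrE ?powR_ge0//.
by rewrite divr_ge0// ltW.
Qed.

Lemma P_convex_le_endpoints (R : realType) (a b : R) (g : R -> R) (x : R) :
  a < b -> P_convex `[a, b] g -> x \in `[a, b] -> g x <= g a + g b.
Proof.
move=> ab [_ gP]; rewrite in_itv/= => /andP[ax xb].
have ba0 : 0 < b - a by rewrite subr_gt0.
have -> : x = (b - x) / (b - a) * a + (1 - (b - x) / (b - a)) * b.
  by field; rewrite gt_eqF.
apply: gP; rewrite in_itv/=; [by rewrite lexx ltW|by rewrite lexx andbT ltW|].
apply/andP; split; first by rewrite divr_ge0 ?subr_ge0// ltW.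
by rewrite ler_pdivrMr// mul1r lerB.
Qed.

Theorem theorem2p2 (R : realType) (a b : R) (f : R -> R) (k p q : R)
  (ha : 0 <= a) (hab : a < b)
  (f_cont : {within `[a, b], continuous f})
  (f_int : lebesgue_measure.-integrable `[a, b] (EFin \o f))
  (hk : 1 < k) (hp : 0 < p) (hq : 0 < q)
  (f_conv : P_convex `[a, b] (fun x => `|f x| `^ (k / (k - 1)))) :
  \int[lebesgue_measure]_(x in `[a, b]) ((x - a) `^ p * (b - x) `^ q * f x)
  <= (b - a) `^ (p + q + 1) * Beta (k * p + 1) (k * q + 1) `^ (1 / k)
     * (`|f a| `^ (k / (k - 1)) + `|f b| `^ (k / (k - 1))) `^ ((k - 1) / k).
Proof.
set M := (X in _ <= _ * X).
have k0 : 0 < k by lra.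
have ba0 : 0 < b - a by rewrite subr_gt0.
have M0 : 0 <= M by exact: powR_ge0.
(* The exponents [k / (k - 1)] and [(k - 1) / k] are reciprocal, so the bound on the power of [|f|]
   turns into one on [f]. An upper bound is enough, as the weight is nonnegative. *)
have fM x : x \in `[a, b] -> f x <= M.
  move=> xab; apply: le_trans (ler_norm _) _.
  have -> : `|f x| = (`|f x| `^ (k / (k - 1))) `^ ((k - 1) / k).
    rewrite -powRrM; have -> : k / (k - 1) * ((k - 1) / k) = 1 by field; lra.
    by rewrite powRr1.
  apply: ge0_ler_powR; rewrite ?nnegrE ?addr_ge0 ?powR_ge0//.
    by rewrite divr_ge0//; lra.
  exact: (P_convex_le_endpoints _ _ _ _ _ hab f_conv).
(* The absolute values make the weight continuous on the whole line without changing it on [[c, d]].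
   The parameters cover both the given weight and the Beta integrand. *)
pose w (r s c d x : R) := `|x - c| `^ r * `|d - x| `^ s.
have cw r s c d : 0 < r -> 0 < s -> continuous (w r s c d).
  move=> r0 s0 x; apply: cvgM.
    apply: (@continuous_comp _ _ _ (fun y => y - c) (fun y => `|y| `^ r)).
      by apply: cvgB; [exact: cvg_id|exact: cvg_cst].
    exact: continuous_norm_powR.
  apply: (@continuous_comp _ _ _ (fun y => d - y) (fun y => `|y| `^ s)).
    by apply: cvgB; [exact: cvg_cst|exact: cvg_id].
  exact: continuous_norm_powR.
have w_ge0 r s c d x : 0 <= w r s c d x by rewrite mulr_ge0// powR_ge0.
have wE r s c d : {in `[c, d]%classic,
    (fun x => (x - c) `^ r * (d - x) `^ s) =1 w r s c d}.
  move=> x; rewrite inE/= in_itv/= => /andP[cx xd].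
  by rewrite /w !ger0_norm ?subr_ge0.
have iw := continuous_Rintegrable_itv _ a b _ (cw p q a b hp hq).
apply: (@le_trans _ _ (\int[lebesgue_measure]_(x in `[a, b]) (w p q a b x * M))).
  rewrite [leLHS](_ : _ =
      \int[lebesgue_measure]_(x in `[a, b]) (w p q a b x * f x)); last first.
    by apply: eq_Rintegral => x xab; rewrite -wE.
  apply: le_Rintegral => //.
  - apply: continuous_compact_integrable; first exact: segment_compact.
    move=> x; apply: cvgM; last exact: f_cont.
    exact: (continuous_subspaceT (cw p q a b hp hq)).
  - apply: continuous_Rintegrable_itv => x.
    by apply: cvgM; [exact: cw|exact: cvg_cst].
  - by move=> x xab; apply: ler_wpM2l => //; exact: fM.
rewrite RintegralZr//; apply: ler_wpM2r => //.
rewrite Rintegral_affine_change//; last exact: cw.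
have wkE (t : R) : w p q 0 1 t `^ k = w (k * p) (k * q) 0 1 t.
  by rewrite /w powRM ?powR_ge0// -!powRrM !(mulrC k).
have -> : Beta (k * p + 1) (k * q + 1) =
    \int[lebesgue_measure]_(t in `[0, 1]) (w p q 0 1 t `^ k).
  apply: eq_Rintegral => t t01; rewrite wkE -wE//.
  by rewrite !addrK subr0.
(* The weight is homogeneous of degree [p + q] in the length of the interval; the last factor
   [b - a] of the bound is the Jacobian. *)
have -> : (fun t => w p q a b (a + (b - a) * t)) =
    (fun t => (b - a) `^ (p + q) * w p q 0 1 t).
  apply/funext => t; rewrite /w.
  have -> : a + (b - a) * t - a = (b - a) * (t - 0) by ring.
  have -> : b - (a + (b - a) * t) = (b - a) * (1 - t) by ring.
  rewrite !normrM !powRM// (gtr0_norm ba0) powRD; last by apply/implyP; rewrite (gt_eqF ba0).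
  by ring.
rewrite RintegralZl//; last exact: continuous_Rintegrable_itv _ _ _ _ (cw _ _ _ _ hp hq).
rewrite (@powRD _ (b - a) (p + q) 1); last by apply/implyP; rewrite (gt_eqF ba0).
rewrite powRr1; last exact: ltW.
rewrite mulrA (mulrC (b - a)).
apply: ler_wpM2l; first by rewrite mulr_ge0 ?powR_ge0 ?ltW.
apply: Rintegral_le_powR_mean => //; first exact: cw.
(* The [k]-th power is again a weight, with exponents [k * p] and [k * q], hence continuous. *)
under [fun t => _]eq_fun do rewrite wkE.
by apply: cw; rewrite mulr_gt0.
Qed.
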